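(* Let $(K,v)$ be a valued field, let $(K^c,v^c)$ be its completion (with $v^cK^c$ identified with $vK$), and let $\Gamma$ be any ordered abelian group containing $vK$ as an ordered subgroup. Consider the diagram in the slice category $\mathbf{vHyp}/\mathcal{T}(\Gamma)$, of shape the poset category associated to $vK_{\geq 0}=\{\gamma\in vK\mid\gamma\geq 0\}$ (with one arrow from $\delta$ to $\gamma$ whenever $\delta\geq\gamma$), whose objects are the valued $\gamma$-hyperfields $v_\gamma:K_\gamma\to\mathcal{T}(\Gamma)$ for $0\leq\gamma\in vK$, and whose arrows are the maps $\rho_{\delta,\gamma}:K_\delta\to K_\gamma$, $[x]_\delta\mapsto[x]_\gamma$, for $\delta\geq\gamma\geq 0$ in $vK$. Then $(K^c,v^c)$ is, up to isomorphism in $\mathbf{vHyp}$, the limit of this diagram in $\mathbf{vHyp}/\mathcal{T}(\Gamma)$, that is, the vertex of a limit cone over it.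
   Context: Ordered abelian groups are linearly ordered, written additively; $\infty$ is a symbol with $\gamma+\infty=\infty+\gamma=\infty>\gamma$ for all $\gamma\in\Gamma$. **Hyperfields.** A (Krasner) hyperfield is $(H,\boxplus,\cdot,0,1)$ where $\boxplus$ assigns to each pair of elements of $H$ a nonempty subset of $H$ and is commutative and associative (with $A\boxplus B=\bigcup_{a\in A,b\in B}a\boxplus b$ for subsets); for every $x$ there is a unique $x^-\in H$ with $0\in x\boxplus x^-$; $z\in x\boxplus y$ implies $y\in z\boxplus x^-$; $x\boxplus 0=\{x\}$; $(H^\times,\cdot,1)$, $H^\times=H\setminus\{0\}$, is an abelian group; $x\cdot 0=0\cdot x=0$; and $x(y\boxplus z)=xy\boxplus xz$. Fields are the hyperfields for which every $x\boxplus y$ is a singleton (a field is a hyperfield with $x\boxplus y=\{x+y\}$). A homomorphism of hyperfields $\sigma:H\to H'$ is a map with $\sigma(0)=0'$ which restricts to a group homomorphism $H^\times\to H'^\times$ and satisfies $\sigma(x\boxplus y)\subseteq\sigma(x)\boxplus'\sigma(y)$ for all $x,y\in H$. **Generalised tropical hyperfield.** $\mathcal{T}(\Gamma)=\Gamma\cup\{\infty\}$ with multiplication the addition $+$ of $\Gamma$ (extended to $\infty$), zero element $\infty$, unit $0$, and hyperaddition $\gamma\boxplus\infty=\infty\boxplus\gamma=\{\gamma\}$; for $\gamma,\delta\in\Gamma$, $\gamma\boxplus\delta=\{\min\{\gamma,\delta\}\}$ if $\gamma\neq\delta$ and $\gamma\boxplus\gamma=\{\varepsilon\in\Gamma\cup\{\infty\}\mid\varepsilon\geq\gamma\}$.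 **Valued hyperfields.** A valuation on a hyperfield $H$ is a map $w:H\to\Gamma\cup\{\infty\}$, $\Gamma$ an ordered abelian group, such that $w(x)=\infty\iff x=0$, $w(xy)=w(x)+w(y)$, and $w(z)\geq\min\{w(x),w(y)\}$ for all $x,y\in H$ and $z\in x\boxplus y$; equivalently, a homomorphism of hyperfields $H\to\mathcal{T}(\Gamma)$. Put $wH=w(H^\times)$ and $\mathcal{O}_w=\{x\in H\mid w(x)\geq 0\}$. For fields this is the usual notion of (Krull) valuation. The category $\mathbf{vHyp}$ has valued hyperfields $(H,w)$ as objects and as arrows $(H,w)\to(H',w')$ the homomorphisms of hyperfields $\sigma:H\to H'$ with $\sigma(\mathcal{O}_w)\subseteq\mathcal{O}_{w'}$. $\mathcal{T}(\Gamma)$ is an object of $\mathbf{vHyp}$ with its identity map as valuation, and a valuation $w:H\to\Gamma\cup\{\infty\}$ is regarded as an arrow $(H,w)\to\mathcal{T}(\Gamma)$, i.e. as an object of the slice category $\mathbf{vHyp}/\mathcal{T}(\Gamma)$. Arrows of the slice category from $f:A\to\mathcal{T}(\Gamma)$ to $g:B\to\mathcal{T}(\Gamma)$ are the $\mathbf{vHyp}$-arrows $a:A\to B$ with $g\circ a=f$. **Valued $\gamma$-hyperfields.** For a valued field $(K,v)$ and $0\leq\gamma\in vK$, let $\mathcal{U}_v^\gamma=\{u\in K\mid v(u-1)>\gamma\}$, a subgroup of $K^\times$; for $x\in K$ let $[x]_\gamma=x\,\mathcal{U}_v^\gamma$ (so $[0]_\gamma=\{0\}$), and $K_\gamma=K^\times/\mathcal{U}_v^\gamma\cup\{[0]_\gamma\}$.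 With $[x]_\gamma\cdot[y]_\gamma=[xy]_\gamma$ and $[x]_\gamma\boxplus[y]_\gamma=\{[x+yu]_\gamma\mid u\in\mathcal{U}_v^\gamma\}$, $K_\gamma$ is a hyperfield, and $v_\gamma[x]_\gamma:=v(x)$ is a well-defined valuation on it. For $vK\subseteq\Gamma$, $v$ and $v_\gamma$ are regarded as maps to $\Gamma\cup\{\infty\}$. **Completion.** Let $\kappa$ be the cofinality of $vK$. A sequence $(x_\nu)_{\nu<\kappa}$ in $K$ is Cauchy if for every $\gamma\in vK$ there is $\nu_0<\kappa$ with $v(x_\nu-x_\mu)>\gamma$ whenever $\nu_0\leq\nu,\mu<\kappa$; it converges to $x$ if for every $\gamma$ in the value group there is $\nu_0<\kappa$ with $v(x-x_\nu)>\gamma$ whenever $\nu_0\leq\nu<\kappa$. $(K,v)$ is complete if every Cauchy sequence in $K$ converges in $K$. The completion $(K^c,v^c)$ of $(K,v)$ is the valued field extension (with $v^c|_K=v$), unique up to isomorphism of valued fields, which is complete and in which $K$ is dense (for every $y\in K^c$ and $\gamma\in v^cK^c$ there is $x\in K$ with $v^c(y-x)>\gamma$). One has $v^cK^c=vK$ canonically, so $v^c$ is regarded as a map $K^c\to\Gamma\cup\{\infty\}$. *)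

(* Defs.v *)
From HB Require Import structures.
From mathcomp Require Import all_boot all_order all_algebra.
From mathcomp Require Import boolp classical_sets.

Set Implicit Arguments.
Unset Strict Implicit.
Unset Printing Implicit Defensive.

Import Order.TTheory GRing.Theory Num.Theory.
Local Open Scope classical_set_scope.
Local Open Scope ring_scope.

HB.mixin Record PorderZmodule_isOrderedAbelianGroup G
    of Num.POrderedZmodule G := {
  le_total_oag : total (<=%R : rel G);
  leD2_oag : forall x y z : G, y <= z -> x + y <= x + z
}.

(* The order is linear by [le_total_oag]; inheriting from [Order.Total] instead
   would need a join below [Num.RealDomain], which HB cannot add afterwards. *)
#[short(type="orderedAbelianGroup")]
HB.structure Definition OrderedAbelianGroup :=
  { G of Num.POrderedZmodule G & PorderZmodule_isOrderedAbelianGroup G }.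

Section OrderedAbelianGroupTheory.
Variable G : orderedAbelianGroup.
Implicit Types x y z : G.

Lemma leD2l x y z : (x + y <= x + z) = (y <= z).
Proof.
apply/idP/idP; last exact: leD2_oag.
by move=> /(leD2_oag (- x)); rewrite !addKr.
Qed.

Lemma addxx0 x : x + x = 0 -> x = 0.
Proof.
move=> xx0; have h := leD2l x x 0; have h' := leD2l x 0 x.
rewrite xx0 addr0 in h h'; apply/le_anti; have := le_total_oag x 0.
by rewrite h h'; case/orP=> ->.
Qed.

End OrderedAbelianGroupTheory.

(* Γ ∪ {∞} *)
Variant ext (G : Type) := Fin of G | Infty.
Arguments Infty {G}.

Section Ext.

Definition ext_to_option G (a : ext G) : option G :=
  if a is Fin x then Some x else None.
Definition option_to_ext G (o : option G) : ext G :=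
  if o is Some x then Fin x else Infty.
Lemma ext_to_optionK G : cancel (@ext_to_option G) (@option_to_ext G).
Proof. by case. Qed.

HB.instance Definition _ (G : choiceType) :=
  Choice.copy (ext G) (can_type (@ext_to_optionK G)).

Variable G : orderedAbelianGroup.
Implicit Types a b c : ext G.

Definition ext_le a b : bool :=
  match a, b with
  | _, Infty => true
  | Infty, Fin _ => false
  | Fin x, Fin y => x <= y
  end.

Fact ext_le_refl : reflexive ext_le.
Proof. by case=> /=. Qed.
Fact ext_le_anti : antisymmetric ext_le.
Proof. by case=> [x|] [y|] //= /le_anti ->. Qed.
Fact ext_le_trans : transitive ext_le.
Proof. by case=> [x|] [y|] [z|] //=; apply: le_trans. Qed.
Fact ext_le_total : total ext_le.
Proof. by case=> [x|] [y|] //=; apply: le_total_oag. Qed.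

HB.instance Definition _ :=
  Order.Le_isPOrder.Build ring_display (ext G)
    ext_le_refl ext_le_anti ext_le_trans.
HB.instance Definition _ :=
  Order.POrder_isTotal.Build ring_display (ext G) ext_le_total.

Definition ext_add a b : ext G :=
  match a, b with Fin x, Fin y => Fin (x + y) | _, _ => Infty end.

Lemma le_Fin (x y : G) : (Fin x <= Fin y) = (x <= y). Proof. by []. Qed.
Lemma lt_Fin (x y : G) : (Fin x < Fin y) = (x < y).
Proof. by rewrite !lt_neqAle. Qed.
Lemma le_Infty a : a <= Infty. Proof. by case: a. Qed.

Lemma ext_addC : commutative ext_add.
Proof. by case=> [x|] [y|] //=; rewrite addrC. Qed.
Lemma ext_addA : associative ext_add.
Proof. by case=> [x|] [y|] [z|] //=; rewrite addrA. Qed.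
Lemma ext_add0 a : ext_add (Fin 0) a = a.
Proof. by case: a => //= x; rewrite add0r. Qed.
Lemma ext_leD2l (x : G) b c :
  (ext_add (Fin x) b <= ext_add (Fin x) c) = (b <= c).
Proof. by case: b c => [y|] [z|] //; exact: leD2l. Qed.

End Ext.

Reserved Notation "x ⊞ y" (at level 50, left associativity).

Record hyperfield := Hyperfield {
  hcarrier :> Type;
  hzero : hcarrier;
  hone : hcarrier;
  hadd : hcarrier -> hcarrier -> set hcarrier;
  hmul : hcarrier -> hcarrier -> hcarrier;
  hadd_nonempty : forall x y, hadd x y !=set0;
  haddC : forall x y, hadd x y = hadd y x;
  haddA : forall x y z,
    \bigcup_(t in hadd x y) hadd t z = \bigcup_(t in hadd y z) hadd x t;
  hopp_unique : forall x, exists! y, hadd x y hzero;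
  hadd_rev : forall x x' y z,
    hadd x x' hzero -> hadd x y z -> hadd z x' y;
  hadd0 : forall x, hadd x hzero = [set x];
  hone_neq0 : hone <> hzero;
  hmul_neq0 : forall x y, x <> hzero -> y <> hzero -> hmul x y <> hzero;
  hmulA : forall x y z, hmul x (hmul y z) = hmul (hmul x y) z;
  hmulC : forall x y, hmul x y = hmul y x;
  hmul1 : forall x, hmul hone x = x;
  hmulV : forall x, x <> hzero ->
    exists y, y <> hzero /\ hmul x y = hone;
  hmul0 : forall x, hmul x hzero = hzero;
  hmulD : forall x y z,
    [set hmul x t | t in hadd y z] = hadd (hmul x y) (hmul x z)
}.
Arguments hzero {h}.
Arguments hone {h}.
Notation "x ⊞ y" := (hadd x y).

Record is_hyperfield_hom (H H' : hyperfield) (s : H -> H') : Prop := {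
  hhom0 : s hzero = hzero;
  hhom_neq0 : forall x, x <> hzero -> s x <> hzero;
  hhomM : forall x y, x <> hzero -> y <> hzero ->
    s (hmul x y) = hmul (s x) (s y);
  hhomD : forall x y, s @` (x ⊞ y) `<=` s x ⊞ s y
}.

Lemma is_hyperfield_hom_id (H : hyperfield) : is_hyperfield_hom (@id H).
Proof. by split=> // x y; rewrite image_id. Qed.

Lemma is_hyperfield_hom_comp (H1 H2 H3 : hyperfield)
    (g : H2 -> H3) (f : H1 -> H2) :
  is_hyperfield_hom g -> is_hyperfield_hom f -> is_hyperfield_hom (g \o f).
Proof.
move=> hg hf; split=> /=.
- by rewrite (hhom0 hf) (hhom0 hg).
- by move=> x /(hhom_neq0 hf) /(hhom_neq0 hg).
- move=> x y x0 y0; rewrite (hhomM hf) // (hhomM hg) //; exact: (hhom_neq0 hf).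
- move=> x y _ [z xyz <-]; apply: (hhomD hg); exists (f z) => //.
  by apply: (hhomD hf); exists z.
Qed.

Record valuation (H : hyperfield) (G : orderedAbelianGroup) := Valuation {
  vfun :> H -> ext G;
  val_Infty : forall x, vfun x = Infty <-> x = hzero;
  valM : forall x y, vfun (hmul x y) = ext_add (vfun x) (vfun y);
  valD : forall x y z, (x ⊞ y) z -> Order.min (vfun x) (vfun y) <= vfun z
}.

Definition value_group (H : hyperfield) (G : orderedAbelianGroup)
    (w : valuation H G) : set G :=
  [set g | exists2 x, x <> hzero & w x = Fin g].

Definition valuation_ring (H : hyperfield) (G : orderedAbelianGroup)
    (w : valuation H G) : set H :=
  [set x | Fin 0 <= w x].

Section ValuationTheory.
Variables (H : hyperfield) (G : orderedAbelianGroup) (w : valuation H G).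

Lemma val0 : w hzero = Infty. Proof. exact/val_Infty. Qed.

Lemma val_fin x : x <> hzero -> exists g, w x = Fin g.
Proof.
move=> x0; case E: (w x) => [g|]; first by exists g.
by case: x0; apply/(val_Infty w).
Qed.

Lemma val1 : w hone = Fin 0.
Proof.
have [g wg] := val_fin (@hone_neq0 H).
have := valM w hone hone; rewrite hmul1 wg => -[] /eqP.
by rewrite -subr_eq0 opprD addNKr oppr_eq0 => /eqP ->.
Qed.

Lemma hopp_mul (x e : H) : (hone ⊞ e) hzero -> (x ⊞ hmul x e) hzero.
Proof.
move=> he; have := hmulD x hone e; rewrite (hmulC x hone) hmul1 => <-.
by exists hzero => //; rewrite hmul0.
Qed.

Lemma val_opp x y : (x ⊞ y) hzero -> w y = w x.
Proof.
have [e [he _]] := hopp_unique (@hone H).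
move=> xy; have -> : y = hmul x e.
  have [t [_ ht]] := hopp_unique x.
  by rewrite -(ht _ xy) -(ht _ (hopp_mul x he)).
have ee : hmul e e = hone.
  have [t [_ ht]] := hopp_unique e.
  rewrite -(ht _ (hopp_mul e he)); apply: ht; by rewrite haddC.
rewrite valM ext_addC.
have e0 : e <> hzero.
  by move=> e0; move: he; rewrite e0 hadd0 => /esym; exact: hone_neq0.
have [g wg] := val_fin e0.
have := valM w e e; rewrite ee val1 wg => -[] /esym /addxx0 ->.
by rewrite ext_add0.
Qed.

End ValuationTheory.

Section GeneralisedTropical.
Variable G : orderedAbelianGroup.
Implicit Types a b c : ext G.

Definition trop_add a b : set (ext G) :=
  match a, b with
  | _, Infty => [set a]
  | Infty, _ => [set b]
  | Fin _, Fin _ =>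
      if a == b then [set e | a <= e] else [set Order.min a b]
  end.

Lemma trop_addP a b c : trop_add a b c <->
  [/\ Order.min a b <= c, Order.min a c <= b & Order.min b c <= a].
Proof.
have -> : trop_add a b c <->
    (if a == b then is_true (a <= c) else c = Order.min a b).
  case: a b => [x|] [y|] /=.
  - by case: ifP.
  - by [].
  - by [].
  - by split=> [->//|]; case: c.
case: (ltgtP a b) => [ab|ba|->].
- split=> [->|[h1 h2 h3]]; first by split; rewrite ?ge_min ?lexx ?(ltW ab) ?orbT.
  apply/le_anti; rewrite h1 andbT; move: h3; rewrite ge_min => /orP[|//].
  by rewrite leNgt ab.
- split=> [->|[h1 h2 h3]]; first by split; rewrite ?ge_min ?lexx ?(ltW ba) ?orbT.
  apply/le_anti; rewrite h1 andbT; move: h2; rewrite ge_min => /orP[|//].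
  by rewrite leNgt ba.
- by split=> [h|[]//]; split; rewrite ?ge_min ?lexx ?h ?orbT.
Qed.

Lemma trop_addC a b : trop_add a b = trop_add b a.
Proof.
apply/seteqP; split=> c /trop_addP[h1 h2 h3]; apply/trop_addP;
  by rewrite minC.
Qed.

Lemma trop_add_cyc a b c : trop_add a b c -> trop_add a c b.
Proof.
by move=> /trop_addP[h1 h2 h3]; apply/trop_addP; split=> //; rewrite minC.
Qed.


Lemma trop_addA_sub a b c :
  \bigcup_(t in trop_add a b) trop_add t c `<=`
  \bigcup_(t in trop_add b c) trop_add a t.
Proof.
have Q (x y z w t : ext G) : Order.min x t <= y -> Order.min z w <= t ->
    [|| x <= y, z <= y | w <= y].
  rewrite !ge_min => /orP[->//|ty] /orP[] /le_trans /(_ ty) -> //.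
  by rewrite orbT.
  by rewrite !orbT.
move=> d [t /trop_addP[h1 h2 h3] /trop_addP[k1 k2 k3]].
have {Q h1 h2 h3 k1 k2 k3} [Qa Qb Qc Qd] : [/\ [|| b <= a, c <= a | d <= a],
    [|| a <= b, c <= b | d <= b], [|| d <= c, a <= c | b <= c] &
    [|| c <= d, a <= d | b <= d]].
  split; [exact: Q h3 k3 | exact: Q h2 k3 | |].
  - by apply: (Q _ _ _ _ t) h1; rewrite minC.
  - by apply: (Q _ _ _ _ t) h1; rewrite minC.
case: (ltgtP b c) => [bc|cb|bc].
- exists b; apply/trop_addP; split; rewrite ?ge_min ?lexx ?(ltW bc) ?orbT//.
  + by case/or3P: Qd => [/(le_trans (ltW bc)) ->|->|->]; rewrite ?orbT.
  + by case/or3P: Qb => [->| |->]; rewrite ?orbT// (leNgt c) bc.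
  + by case/or3P: Qa => [->|/(le_trans (ltW bc)) ->|->]; rewrite ?orbT.
- exists c; apply/trop_addP; split; rewrite ?ge_min ?lexx ?(ltW cb) ?orbT//.
  + by case/or3P: Qd => [->|->|/(le_trans (ltW cb)) ->]; rewrite ?orbT.
  + by case/or3P: Qc => [->|->|]; rewrite ?orbT// (leNgt b) cb.
  + by case/or3P: Qa => [/(le_trans (ltW cb)) ->|->|->]; rewrite ?orbT.
subst c; case: (ltgtP a d) => [ad|da|<-{d Qa Qb Qc Qd}].
- have ba : b <= a by case/or3P: Qa => //; rewrite leNgt ad.
  by exists a; apply/trop_addP; split; rewrite ?ge_min ?lexx ?ba ?(ltW ad) ?orbT.
- have bd : b <= d by case/or3P: Qd => //; rewrite leNgt da.
  by exists d; apply/trop_addP; split; rewrite ?ge_min ?lexx ?bd ?(ltW da) ?orbT.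
- by exists (Order.max a b); apply/trop_addP; split;
    rewrite ?ge_min ?le_max ?lexx ?orbT.
Qed.

Lemma trop_addA a b c :
  \bigcup_(t in trop_add a b) trop_add t c =
  \bigcup_(t in trop_add b c) trop_add a t.
Proof.
apply/seteqP; split; first exact: trop_addA_sub.
move=> d [t bct atd]; have [] := @trop_addA_sub c b a d.
  by exists t; rewrite trop_addC.
by move=> s bas csd; exists s; rewrite trop_addC.
Qed.

Lemma trop_add_nonempty a b : trop_add a b !=set0.
Proof.
exists (Order.min a b); apply/trop_addP; split; rewrite ?ge_min ?lexx ?orbT//.
by rewrite !le_min !lexx andbT le_total.
Qed.

Lemma trop_add0 a : trop_add a Infty = [set a].
Proof. by case: a. Qed.

Lemma trop_add_Infty a b : trop_add a b Infty -> b = a.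
Proof.
move=> /trop_addP[_ h1 h2]; apply/le_anti; move: h1 h2.
by rewrite !ge_min => /orP[->|+] /orP[->|+] //; case: (a) (b) => [x|] [y|].
Qed.

Lemma trop_opp_unique a : exists! b, trop_add a b Infty.
Proof.
exists a; split=> [|b /trop_add_Infty ->//].
by apply/trop_addP; split; rewrite ?ge_min ?le_Infty ?lexx.
Qed.

Lemma trop_add_rev a a' b c :
  trop_add a a' Infty -> trop_add a b c -> trop_add c a' b.
Proof.
by move=> /trop_add_Infty -> /trop_add_cyc; rewrite trop_addC.
Qed.

Lemma Fin0_neq_Infty : Fin (0 : G) <> Infty.
Proof. by []. Qed.

Lemma ext_add_neq_Infty a b :
  a <> Infty -> b <> Infty -> ext_add a b <> Infty.
Proof. by case: a b => [x|] [y|]. Qed.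

Lemma ext_addV a : a <> Infty ->
  exists b, b <> Infty /\ ext_add a b = Fin 0.
Proof. by case: a => // x _; exists (Fin (- x)); rewrite /= addrN. Qed.

Lemma ext_add_Infty a : ext_add a Infty = Infty.
Proof. by case: a. Qed.

Lemma trop_distr a b c :
  [set ext_add a t | t in trop_add b c] =
  trop_add (ext_add a b) (ext_add a c).
Proof.
case: a => [x|]; last first.
  apply/seteqP; split=> [_ [t _ <-]//|t /= ->].
  by have [u bcu] := trop_add_nonempty b c; exists u.
apply/seteqP; split=> [_ [t /trop_addP + <-]|t /trop_addP].
  by rewrite !ge_min => h; apply/trop_addP; rewrite !ge_min !ext_leD2l.
have <- : ext_add (Fin x) (ext_add (Fin (- x)) t) = t.
  by case: t => //= y; rewrite addrA addrN add0r.
rewrite !ge_min !ext_leD2l => h.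
by exists (ext_add (Fin (- x)) t) => //; apply/trop_addP; rewrite !ge_min.
Qed.

Definition tropical : hyperfield :=
  @Hyperfield (ext G) Infty (Fin 0) trop_add (@ext_add G)
    trop_add_nonempty trop_addC trop_addA trop_opp_unique trop_add_rev
    trop_add0 Fin0_neq_Infty ext_add_neq_Infty (@ext_addA G)
    (@ext_addC G) (@ext_add0 G) ext_addV ext_add_Infty trop_distr.

Lemma tropical_id_valD (x y z : tropical) :
  (x ⊞ y) z -> Order.min (x : ext G) y <= (z : ext G).
Proof. by case/trop_addP. Qed.

Definition tropical_id : valuation tropical G :=
  @Valuation tropical G id (fun=> iff_refl _) (fun _ _ => erefl)
    tropical_id_valD.

End GeneralisedTropical.

Lemma valuation_hom (H : hyperfield) (G : orderedAbelianGroup)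
  (w : valuation H G) : @is_hyperfield_hom H (tropical G) w.
Proof.
split.
- exact: val0.
- by move=> x x0 /(val_Infty w).
- by move=> x y _ _; exact: valM.
- move=> x y _ [z xyz <-]; apply/trop_addP.
  have [x' [xx' _]] := hopp_unique x; have [y' [yy' _]] := hopp_unique y.
  split; first exact: valD.
  + have := hadd_rev xx' xyz => /(valD w); rewrite (val_opp w xx').
    by rewrite minC.
  + rewrite haddC in xyz; have := hadd_rev yy' xyz => /(valD w).
    by rewrite (val_opp w yy') minC.
Qed.

Section FieldHyperfield.
Variable K : fieldType.
Implicit Types x y z : K.

Definition field_add x y : set K := [set x + y].

Lemma field_add_nonempty x y : field_add x y !=set0.
Proof. by exists (x + y). Qed.

Lemma field_addC x y : field_add x y = field_add y x.
Proof. by rewrite /field_add addrC. Qed.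

Lemma field_addA x y z :
  \bigcup_(t in field_add x y) field_add t z =
  \bigcup_(t in field_add y z) field_add x t.
Proof. by rewrite !bigcup_set1 /field_add addrA. Qed.

Lemma field_opp_unique x : exists! y, field_add x y 0.
Proof.
exists (- x); split=> [|y /= /esym/eqP]; first by rewrite /field_add /= subrr.
by rewrite addrC addr_eq0 => /eqP ->; rewrite ?opprK.
Qed.

Lemma field_add_rev x x' y z :
  field_add x x' 0 -> field_add x y z -> field_add z x' y.
Proof.
by move=> /= xx' ->; rewrite /field_add /= addrAC -xx' add0r.
Qed.

Lemma field_add0 x : field_add x 0 = [set x].
Proof. by rewrite /field_add addr0. Qed.

Lemma field_one_neq0 : (1 : K) <> 0. Proof. exact/eqP/oner_neq0. Qed.

Lemma field_mul_neq0 x y : x <> 0 -> y <> 0 -> x * y <> 0.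
Proof. by move=> /eqP x0 /eqP y0; apply/eqP; rewrite mulf_neq0. Qed.

Lemma field_mulV x : x <> 0 -> exists y, y <> 0 /\ x * y = 1.
Proof.
move=> /eqP x0; exists x^-1; rewrite mulfV//; split=> //.
by apply/eqP; rewrite invr_eq0.
Qed.

Lemma field_distr x y z :
  [set x * t | t in field_add y z] = field_add (x * y) (x * z).
Proof. by rewrite image_set1 mulrDr. Qed.

Definition field_hyperfield : hyperfield :=
  @Hyperfield K 0 1 field_add *%R field_add_nonempty field_addC field_addA
    field_opp_unique field_add_rev field_add0 field_one_neq0 field_mul_neq0
    (@mulrA K) (@mulrC K) (@mul1r K) field_mulV (@mulr0 K) field_distr.

End FieldHyperfield.

Notation krull_valuation K G := (valuation (field_hyperfield K) G).

Section KrullValuationTheory.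
Variables (K : fieldType) (G : orderedAbelianGroup) (v : krull_valuation K G).
Implicit Types x y : K.

Lemma kval0 : v (0 : K) = Infty. Proof. exact: (val0 v). Qed.
Lemma kval1 : v (1 : K) = Fin 0. Proof. exact: (val1 v). Qed.
Lemma kvalM x y : v (x * y) = ext_add (v x) (v y). Proof. exact: (valM v). Qed.
Lemma kvalD x y : Order.min (v x) (v y) <= v (x + y).
Proof. exact: (@valD _ _ v x y). Qed.
Lemma kvalN x : v (- x) = v x.
Proof. by apply: (val_opp v); rewrite /= /field_add /= subrr. Qed.
Lemma kval_Infty x : v x = Infty <-> x = 0. Proof. exact: (val_Infty v). Qed.

End KrullValuationTheory.

(* A field modulo a subgroup [U] of its unit group. The elements are the cosets
   x U, as subsets of K; the operations are defined on representatives, and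
   [clsM], [clsD] show that the choice of representatives does not matter. *)
Section Cosets.
Variables (K : fieldType) (U : set K).
Implicit Types x y z : K.

Record unit_subgroup : Prop := {
  unit_subgroup0 : ~ U 0;
  unit_subgroup1 : U 1;
  unit_subgroupM : forall x y, U x -> U y -> U (x * y);
  unit_subgroupV : forall x, U x -> U x^-1
}.

Definition coset x : set K := [set x * u | u in U].

Definition coset_type : Type := {A : set K | range coset A}.

Definition cls x : coset_type := exist _ (coset x) (imageT coset x).

Definition rep (A : coset_type) : K := sval (cid2 (svalP A)).

Lemma coset_type_eq (A B : coset_type) : sval A = sval B -> A = B.
Proof. by case: A B => [A pA] [B pB] /= AB; exact: eq_exist. Qed.

Lemma repK A : cls (rep A) = A.
Proof.
by apply: coset_type_eq; rewrite /rep /=; case: cid2.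
Qed.

Definition cls_mul (A B : coset_type) : coset_type := cls (rep A * rep B).

Definition cls_add (A B : coset_type) : set coset_type :=
  [set cls (rep A + rep B * u) | u in U].

Hypothesis hU : unit_subgroup.

Lemma unit_subgroup_neq0 u : U u -> u != 0.
Proof. by move=> Uu; apply/eqP => u0; apply: (unit_subgroup0 hU); rewrite -u0. Qed.

Lemma clsP x y : cls x = cls y <-> exists2 u, U u & x = y * u.
Proof.
split=> [[xy]|[u Uu ->]].
  have : coset x x by exists 1; [exact: unit_subgroup1 | rewrite mulr1].
  by rewrite xy => -[u Uu <-]; exists u.
apply: coset_type_eq => /=; apply/seteqP; split=> _ [w Uw <-].
  by exists (u * w); [exact: unit_subgroupM | rewrite mulrA].
exists (u^-1 * w); first by apply: unit_subgroupM => //; exact: unit_subgroupV.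
by rewrite mulrA mulfK// unit_subgroup_neq0.
Qed.

Lemma rep_cls x : exists2 u, U u & rep (cls x) = x * u.
Proof. by apply/clsP; rewrite repK. Qed.

Lemma clsM x y : cls_mul (cls x) (cls y) = cls (x * y).
Proof.
have [a Ua xa] := rep_cls x; have [b Ub yb] := rep_cls y.
apply/clsP; exists (a * b); first exact: unit_subgroupM.
by rewrite xa yb mulrACA.
Qed.

Lemma clsD x y :
  cls_add (cls x) (cls y) = [set cls (x + y * u) | u in U].
Proof.
have [a Ua xa] := rep_cls x; have [b Ub yb] := rep_cls y.
have a0 := unit_subgroup_neq0 Ua; have b0 := unit_subgroup_neq0 Ub.
apply/seteqP; split=> _ [u Uu <-].
  exists (b * u * a^-1).
    apply: unit_subgroupM => //; last exact: unit_subgroupV.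
    exact: unit_subgroupM.
  apply/esym/clsP; exists a => //; rewrite xa yb mulrDl; congr (_ + _).
  by rewrite !mulrA mulfVK.
exists (u * a * b^-1).
  apply: unit_subgroupM => //; last exact: unit_subgroupV.
  exact: unit_subgroupM.
apply/clsP; exists a => //; rewrite xa yb mulrDl; congr (_ + _).
by rewrite [u * a * _]mulrC !mulrA mulfK.
Qed.

Lemma cls_eq0 x : cls x = cls 0 <-> x = 0.
Proof.
split=> [/clsP[u _ ->]|->//]; exact: mul0r.
Qed.

Lemma cls_ind (P : coset_type -> Prop) : (forall x, P (cls x)) -> forall A, P A.
Proof. by move=> h A; rewrite -(repK A). Qed.

Lemma cls_add_nonempty A B : cls_add A B !=set0.
Proof. by exists (cls (rep A + rep B * 1)), 1 => //; exact: unit_subgroup1. Qed.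

Lemma cls_addC A B : cls_add A B = cls_add B A.
Proof.
suff h x y : cls_add (cls x) (cls y) `<=` cls_add (cls y) (cls x).
  by elim/cls_ind: A => x; elim/cls_ind: B => y; apply/seteqP; split; exact: h.
rewrite !clsD => _ [u Uu <-]; have u0 := unit_subgroup_neq0 Uu.
exists u^-1; first exact: unit_subgroupV.
apply/clsP; exists u^-1; first exact: unit_subgroupV.
by rewrite mulrDl mulfK// addrC.
Qed.

Lemma cls_addA A B C :
  \bigcup_(t in cls_add A B) cls_add t C =
  \bigcup_(t in cls_add B C) cls_add A t.
Proof.
elim/cls_ind: A => x; elim/cls_ind: B => y; elim/cls_ind: C => z.
apply/seteqP; split=> D [t]; rewrite clsD => -[u Uu <-]; rewrite clsD.
  have u0 := unit_subgroup_neq0 Uu.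
  move=> [w Uw <-]; exists (cls (y + z * (w * u^-1))).
    rewrite clsD; exists (w * u^-1) => //.
    by apply: unit_subgroupM => //; exact: unit_subgroupV.
  rewrite clsD; exists u => //.
  by rewrite mulrDl -!addrA -[in LHS]mulrA mulfVK// mulrA.
move=> [w Uw <-]; exists (cls (x + y * w)); first by rewrite clsD; exists w.
rewrite clsD; exists (u * w); first exact: unit_subgroupM.
by rewrite mulrDl addrA mulrA.
Qed.

Lemma cls_addN x y : cls_add (cls x) (cls y) (cls 0) -> cls y = cls (- x).
Proof.
rewrite clsD => -[u Uu /cls_eq0]; rewrite addrC => /eqP.
rewrite addr_eq0 => /eqP yu; have u0 := unit_subgroup_neq0 Uu.
by apply/esym/clsP; exists u.
Qed.

Lemma cls_opp_unique A : exists! B, cls_add A B (cls 0).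
Proof.
elim/cls_ind: A => x; exists (cls (- x)); split.
  by rewrite clsD; exists 1; [exact: unit_subgroup1 | rewrite mulr1 subrr].
by move=> B; elim/cls_ind: B => y /cls_addN.
Qed.

Lemma cls_add_rev A A' B C :
  cls_add A A' (cls 0) -> cls_add A B C -> cls_add C A' B.
Proof.
elim/cls_ind: A => x; elim/cls_ind: A' => x'; elim/cls_ind: B => y.
move=> /cls_addN ->; rewrite clsD => -[u Uu <-]; rewrite clsD.
exists 1; first exact: unit_subgroup1.
by apply/clsP; exists u => //; rewrite mulr1 addrC addKr.
Qed.

Lemma cls_add0 A : cls_add A (cls 0) = [set A].
Proof.
elim/cls_ind: A => x; rewrite clsD; apply/seteqP; split=> [_ [u Uu <-]|_ ->].
  by rewrite mul0r addr0.
by exists 1; [exact: unit_subgroup1 | rewrite mul0r addr0].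
Qed.

Lemma cls_one_neq0 : cls 1 <> cls 0.
Proof. by move=> /cls_eq0 /eqP; rewrite oner_eq0. Qed.

Lemma cls_mul_neq0 A B : A <> cls 0 -> B <> cls 0 -> cls_mul A B <> cls 0.
Proof.
elim/cls_ind: A => x; elim/cls_ind: B => y x0 y0; rewrite clsM => /cls_eq0/eqP.
by rewrite mulf_eq0 => /orP[] /eqP z0; [apply: x0 | apply: y0]; rewrite z0.
Qed.

Lemma cls_mulA A B C : cls_mul A (cls_mul B C) = cls_mul (cls_mul A B) C.
Proof.
elim/cls_ind: A => x; elim/cls_ind: B => y; elim/cls_ind: C => z.
by rewrite !clsM mulrA.
Qed.

Lemma cls_mulC A B : cls_mul A B = cls_mul B A.
Proof. by rewrite /cls_mul mulrC. Qed.

Lemma cls_mul1 A : cls_mul (cls 1) A = A.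
Proof. by elim/cls_ind: A => x; rewrite clsM mul1r. Qed.

Lemma cls_mulV A : A <> cls 0 -> exists B, B <> cls 0 /\ cls_mul A B = cls 1.
Proof.
elim/cls_ind: A => x hx; have x0 : x != 0 by apply/eqP => x0; rewrite x0 in hx.
exists (cls x^-1); rewrite clsM mulfV//; split=> // /cls_eq0/eqP.
by rewrite invr_eq0 (negbTE x0).
Qed.

Lemma cls_mul0 A : cls_mul A (cls 0) = cls 0.
Proof. by elim/cls_ind: A => x; rewrite clsM mulr0. Qed.

Lemma cls_distr A B C :
  [set cls_mul A t | t in cls_add B C] =
  cls_add (cls_mul A B) (cls_mul A C).
Proof.
elim/cls_ind: A => x; elim/cls_ind: B => y; elim/cls_ind: C => z.
rewrite !clsM !clsD; apply/seteqP; split.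
  by move=> _ [_ [u Uu <-] <-]; exists u => //; rewrite clsM mulrDr mulrA.
move=> _ [u Uu <-]; exists (cls (y + z * u)); first by exists u.
by rewrite clsM mulrDr mulrA.
Qed.

Definition coset_hyperfield : hyperfield :=
  @Hyperfield coset_type (cls 0) (cls 1) cls_add cls_mul cls_add_nonempty
    cls_addC cls_addA cls_opp_unique cls_add_rev cls_add0 cls_one_neq0
    cls_mul_neq0 cls_mulA cls_mulC cls_mul1 cls_mulV cls_mul0 cls_distr.

End Cosets.

Section GammaHyperfield.
Variables (K : fieldType) (G : orderedAbelianGroup) (v : krull_valuation K G).
Implicit Types x y : K.

Definition one_units (g : G) : set K := [set u | Fin g < v (u - 1)].

Definition value_group_ge0 : set G := [set g | value_group v g /\ 0 <= g].

Lemma val_one_unit (g : G) x : 0 <= g -> one_units g x -> v x = Fin 0.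
Proof.
rewrite -le_Fin => g0 /(le_lt_trans g0) x1; apply/le_anti/andP; split.
  have := kvalD v x (- (x - 1)); rewrite kvalN opprB addrCA subrr addr0 kval1.
  by rewrite ge_min => /orP[//|]; rewrite leNgt x1.
have := kvalD v (x - 1) 1; rewrite subrK kval1; apply: le_trans.
by rewrite le_min lexx ltW.
Qed.

Lemma one_units_subgroup (g : G) : 0 <= g -> unit_subgroup (one_units g).
Proof.
move=> g0; have U0 x : one_units g x -> v x = Fin 0 by exact: val_one_unit.
split.
- by move=> /U0; rewrite kval0.
- by rewrite /one_units /= subrr kval0.
- move=> x y Ux Uy; rewrite /one_units /=.
  have -> : x * y - 1 = (x - 1) * y + (y - 1).
    by rewrite mulrBl mul1r addrA subrK.
  apply: lt_le_trans (kvalD _ _ _); rewrite lt_min kvalM (U0 y)// ext_addC.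
  by rewrite ext_add0; apply/andP.
- move=> x Ux; have x0 : x != 0.
    by apply/eqP => x0; move: (U0 x Ux); rewrite x0 kval0.
  have vx : v x^-1 = Fin 0.
    have := kvalM v x x^-1; rewrite mulfV// kval1 (U0 x)// ext_add0.
    by move=> /esym.
  rewrite /one_units /=; have -> : x^-1 - 1 = - (x - 1) * x^-1.
    by rewrite mulNr mulrBl mulfV// mul1r opprB.
  by rewrite kvalM kvalN vx ext_addC ext_add0.
Qed.

Definition gamma_subgroup (g : value_group_ge0) :
    unit_subgroup (one_units (val g)) :=
  one_units_subgroup (proj2 (set_valP g)).

Definition gamma_hyperfield (g : value_group_ge0) : hyperfield :=
  coset_hyperfield (gamma_subgroup g).

(* [x]_γ *)
Definition gcls (g : value_group_ge0) (x : K) : gamma_hyperfield g :=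
  cls (one_units (val g)) x.

Definition gamma_val (g : value_group_ge0) (A : gamma_hyperfield g) : ext G :=
  v (rep A).

Lemma gamma_val_cls g x : gamma_val (gcls g x) = v x.
Proof.
have [u Uu ux] := rep_cls (gamma_subgroup g) x.
rewrite /gamma_val ux kvalM (@val_one_unit (val g) u)//.
  by rewrite ext_addC ext_add0.
exact: (proj2 (set_valP g)).
Qed.

Lemma gamma_val_Infty g (A : gamma_hyperfield g) :
  gamma_val A = Infty <-> A = hzero.
Proof.
elim/cls_ind: A => x; rewrite -/(gcls g x) gamma_val_cls kval_Infty.
by split=> [->//|/(cls_eq0 (gamma_subgroup g))].
Qed.

Lemma gamma_valM g (A B : gamma_hyperfield g) :
  gamma_val (hmul A B) = ext_add (gamma_val A) (gamma_val B).
Proof.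
elim/cls_ind: A => x; elim/cls_ind: B => y.
rewrite /= (clsM (gamma_subgroup g)) -!/(gcls g _) !gamma_val_cls.
exact: kvalM.
Qed.

Lemma gamma_valD g (A B C : gamma_hyperfield g) :
  (A ⊞ B) C -> Order.min (gamma_val A) (gamma_val B) <= gamma_val C.
Proof.
elim/cls_ind: A => x; elim/cls_ind: B => y.
rewrite /= (clsD (gamma_subgroup g)) => -[u Uu <-].
rewrite -!/(gcls g _) !gamma_val_cls; apply: le_trans (kvalD _ _ _).
rewrite kvalM (@val_one_unit (val g) u)//; last exact: (proj2 (set_valP g)).
by rewrite [ext_add _ (Fin 0)]ext_addC ext_add0.
Qed.

Definition gamma_valuation (g : value_group_ge0) :
    valuation (gamma_hyperfield g) G :=
  Valuation (@gamma_val_Infty g) (@gamma_valM g) (@gamma_valD g).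

Definition rho (d g : value_group_ge0) (A : gamma_hyperfield d) :
    gamma_hyperfield g :=
  gcls g (rep A).

Section Rho.
Variables (d g : value_group_ge0).
Hypothesis gd : val g <= val d.

Lemma sub_one_units : one_units (val d) `<=` one_units (val g).
Proof. by move=> u; apply: le_lt_trans; rewrite le_Fin. Qed.

Lemma rho_cls x : rho g (gcls d x) = gcls g x.
Proof.
have [u Uu ux] := rep_cls (gamma_subgroup d) x.
apply/(clsP (gamma_subgroup g)); exists u; [exact: sub_one_units | exact: ux].
Qed.

Lemma rho_hom : is_hyperfield_hom (@rho d g).
Proof.
split.
- exact: rho_cls.
- move=> A; elim/cls_ind: A => x x0; rewrite -/(gcls d x) rho_cls.
  by move=> /(cls_eq0 (gamma_subgroup g)) x00; apply: x0; rewrite x00.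
- move=> A B _ _; elim/cls_ind: A => x; elim/cls_ind: B => y.
  rewrite /= (clsM (gamma_subgroup d)) -!/(gcls d _) !rho_cls.
  by rewrite (clsM (gamma_subgroup g)).
- move=> A B; elim/cls_ind: A => x; elim/cls_ind: B => y _ [C + <-].
  rewrite /= (clsD (gamma_subgroup d)) => -[u Uu <-].
  rewrite -!/(gcls d _) !rho_cls (clsD (gamma_subgroup g)).
  by exists u => //; exact: sub_one_units.
Qed.

Lemma rho_val (A : gamma_hyperfield d) :
  gamma_valuation g (rho g A) = gamma_valuation d A.
Proof. by elim/cls_ind: A => x; rewrite -/(gcls d x) rho_cls /= !gamma_val_cls. Qed.

End Rho.

End GammaHyperfield.

Record category := Category {
  obj :> Type;
  hom : obj -> obj -> Type;
  idm : forall a, hom a a;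
  comp : forall a b c, hom b c -> hom a b -> hom a c;
  compA : forall a b c d (f : hom c d) (g : hom b c) (h : hom a b),
    comp f (comp g h) = comp (comp f g) h;
  comp1m : forall a b (f : hom a b), comp (idm b) f = f;
  compm1 : forall a b (f : hom a b), comp f (idm a) = f
}.
Arguments idm {_} _.
Arguments comp {_ _ _ _}.

Record functor (J C : category) := Functor {
  fobj :> J -> C;
  fmap : forall i j, hom i j -> hom (fobj i) (fobj j);
  fmap1 : forall i, fmap (idm i) = idm (fobj i);
  fmapM : forall i j k (f : hom j k) (g : hom i j),
    fmap (comp f g) = comp (fmap f) (fmap g)
}.

Record cone (J C : category) (F : functor J C) (x : C) := Cone {
  leg :> forall j, hom x (F j);
  leg_comm : forall i j (f : hom i j), comp (fmap F f) (leg i) = leg j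
}.

Definition is_limit_cone (J C : category) (F : functor J C) (x : C)
    (c : cone F x) : Prop :=
  forall (y : C) (d : cone F y),
    exists! h : hom y x, forall j, comp (c j) h = d j.

(* The full subcategory on [S] of the poset [G] with reversed order. *)
Definition ge_category (G : porderZmodType) (S : set G) : category :=
  @Category S (fun d g => val g <= val d)
    (fun=> lexx _) (fun _ _ _ gh fg => le_trans gh fg)
    (fun _ _ _ _ _ _ _ => bool_irrelevance _ _)
    (fun _ _ _ => bool_irrelevance _ _) (fun _ _ _ => bool_irrelevance _ _).

Section Slice.
Variables (C : category) (x : C).

Record slice_obj := SliceObj {
  slice_dom : C;
  slice_arr : hom slice_dom x
}.

Record slice_hom (a b : slice_obj) := SliceHom {
  slice_map : hom (slice_dom a) (slice_dom b);
  slice_comm : comp (slice_arr b) slice_map = slice_arr a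
}.

Lemma slice_hom_eq a b (f g : slice_hom a b) :
  slice_map f = slice_map g -> f = g.
Proof.
case: f g => [f pf] [g pg] /= fg; subst g; congr SliceHom.
exact: Prop_irrelevance.
Qed.

Definition slice_id a : slice_hom a a := SliceHom (compm1 (slice_arr a)).

Definition slice_comp a b c (f : slice_hom b c) (g : slice_hom a b) :
  slice_hom a c.
Proof.
exists (comp (slice_map f) (slice_map g)).
abstract by rewrite compA !slice_comm.
Defined.

Lemma slice_compA a b c d
    (f : slice_hom c d) (g : slice_hom b c) (h : slice_hom a b) :
  slice_comp f (slice_comp g h) = slice_comp (slice_comp f g) h.
Proof. apply: slice_hom_eq; exact: compA. Qed.

Lemma slice_comp1m a b (f : slice_hom a b) : slice_comp (slice_id b) f = f.
Proof. apply: slice_hom_eq; exact: comp1m. Qed.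

Lemma slice_compm1 a b (f : slice_hom a b) : slice_comp f (slice_id a) = f.
Proof. apply: slice_hom_eq; exact: compm1. Qed.

Definition slice : category :=
  @Category slice_obj slice_hom slice_id slice_comp
    slice_compA slice_comp1m slice_compm1.

End Slice.

Section VHyp.

Record valued_hyperfield := ValuedHyperfield {
  vh_hyperfield :> hyperfield;
  vh_group : orderedAbelianGroup;
  vh_val : valuation vh_hyperfield vh_group
}.

Record vhyp_hom (A B : valued_hyperfield) := VHypHom {
  vhyp_map :> A -> B;
  vhyp_map_hom : is_hyperfield_hom vhyp_map;
  vhyp_map_ring :
    vhyp_map @` valuation_ring (vh_val A) `<=` valuation_ring (vh_val B)
}.

Lemma vhyp_hom_eq A B (f g : vhyp_hom A B) : f =1 g -> f = g.
Proof.
case: f g => [f f1 f2] [g g1 g2] /= /funext fg; subst g.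
by congr VHypHom; exact: Prop_irrelevance.
Qed.

Definition vhyp_id A : vhyp_hom A A.
Proof.
exists id; first exact: is_hyperfield_hom_id.
abstract by rewrite image_id.
Defined.

Definition vhyp_comp A B C (f : vhyp_hom B C) (g : vhyp_hom A B) :
  vhyp_hom A C.
Proof.
exists (f \o g).
  exact: is_hyperfield_hom_comp (vhyp_map_hom f) (vhyp_map_hom g).
abstract by move=> _ [x Ax <-]; apply: (@vhyp_map_ring _ _ f); exists (g x) => //;
  apply: (@vhyp_map_ring _ _ g); exists x.
Defined.

Lemma vhyp_compA A B C D
    (f : vhyp_hom C D) (g : vhyp_hom B C) (h : vhyp_hom A B) :
  vhyp_comp f (vhyp_comp g h) = vhyp_comp (vhyp_comp f g) h.
Proof. exact: vhyp_hom_eq. Qed.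

Lemma vhyp_comp1m A B (f : vhyp_hom A B) : vhyp_comp (vhyp_id B) f = f.
Proof. exact: vhyp_hom_eq. Qed.

Lemma vhyp_compm1 A B (f : vhyp_hom A B) : vhyp_comp f (vhyp_id A) = f.
Proof. exact: vhyp_hom_eq. Qed.

Definition vHyp : category :=
  @Category valued_hyperfield vhyp_hom vhyp_id vhyp_comp
    vhyp_compA vhyp_comp1m vhyp_compm1.

Definition vtropical (G : orderedAbelianGroup) : vHyp :=
  ValuedHyperfield (tropical_id G).

Variables (H : hyperfield) (G : orderedAbelianGroup) (w : valuation H G).

Lemma val_arrow_ring :
  w @` valuation_ring w `<=` valuation_ring (tropical_id G).
Proof. by move=> _ [x wx <-]. Qed.

Definition val_arrow :
    @hom vHyp (ValuedHyperfield w) (vtropical G) :=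
  @VHypHom (ValuedHyperfield w) (vtropical G) w (valuation_hom w)
    val_arrow_ring.

(* A valuation w : H -> Γ ∪ {∞} as an object of vHyp / T(Γ). *)
Definition val_slice : slice (vtropical G) := SliceObj val_arrow.

End VHyp.

Section Diagram.
Variables (K : fieldType) (G : orderedAbelianGroup) (v : krull_valuation K G).

Definition gamma_obj (g : value_group_ge0 v) : slice (vtropical G) :=
  val_slice (gamma_valuation g).

Lemma rho_ring (d g : value_group_ge0 v) : val g <= val d ->
  @rho _ _ v d g @` valuation_ring (gamma_valuation d) `<=`
  valuation_ring (gamma_valuation g).
Proof.
by move=> gd _ [x xd <-]; rewrite /valuation_ring /mkset (rho_val gd).
Qed.

Definition rho_vhyp (d g : value_group_ge0 v) (gd : val g <= val d) :
    @hom vHyp (ValuedHyperfield (gamma_valuation d))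
      (ValuedHyperfield (gamma_valuation g)) :=
  @VHypHom (ValuedHyperfield (gamma_valuation d))
    (ValuedHyperfield (gamma_valuation g)) (@rho _ _ v d g) (rho_hom gd)
    (rho_ring gd).

Lemma rho_comm (d g : value_group_ge0 v) (gd : val g <= val d) :
  comp (slice_arr (gamma_obj g)) (rho_vhyp gd) = slice_arr (gamma_obj d).
Proof. apply: vhyp_hom_eq => A; exact: (rho_val gd). Qed.

Definition rho_arrow (d g : value_group_ge0 v) (gd : val g <= val d) :
    hom (gamma_obj d) (gamma_obj g) :=
  @SliceHom vHyp (vtropical G) (gamma_obj d) (gamma_obj g)
    (rho_vhyp gd) (rho_comm gd).

Lemma rho_arrow1 (g : ge_category (value_group_ge0 v)) :
  rho_arrow (idm g) = idm (gamma_obj g).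
Proof.
apply: slice_hom_eq; apply: vhyp_hom_eq => A; elim/cls_ind: A => x.
exact: (rho_cls (lexx (val g))).
Qed.

Lemma rho_arrowM (e d g : ge_category (value_group_ge0 v))
    (gd : hom d g) (de : hom e d) :
  rho_arrow (comp gd de) = comp (rho_arrow gd) (rho_arrow de).
Proof.
apply: slice_hom_eq; apply: vhyp_hom_eq => A; elim/cls_ind: A => x.
rewrite /= -/(gcls e x) (rho_cls de) (rho_cls gd).
exact: (rho_cls (le_trans gd de)).
Qed.

Definition gamma_diagram :
    functor (ge_category (value_group_ge0 v)) (slice (vtropical G)) :=
  @Functor (ge_category (value_group_ge0 v)) (slice (vtropical G))
    gamma_obj rho_arrow rho_arrow1 rho_arrowM.

End Diagram.

Definition is_well_order d (I : orderType d) : Prop :=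
  forall A : set I, A !=set0 -> exists2 i, A i & forall j, A j -> (i <= j)%O.

Definition has_cofinal_map d (I : orderType d) (G : porderZmodType)
    (S : set G) : Prop :=
  exists2 f : I -> G, range f `<=` S & forall s, S s -> exists i, s <= f i.

(* [I] is a representative of the ordinal cof(S), the least ordinal with a
   cofinal map into S. *)
Definition is_cofinality d (I : orderType d) (G : porderZmodType)
    (S : set G) : Prop :=
  [/\ is_well_order I, has_cofinal_map I S &
    forall d' (J : orderType d'), is_well_order J -> has_cofinal_map J S ->
      exists f : I -> J, {homo f : i j / (i < j)%O}].

Section Completion.
Variables (K : fieldType) (G : orderedAbelianGroup) (v : krull_valuation K G).
Variables (d : Order.disp_t) (I : orderType d).
Implicit Type x : I -> K.

Definition is_cauchy x : Prop :=
  forall g, value_group v g -> exists i0, forall i j,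
    (i0 <= i)%O -> (i0 <= j)%O -> Fin g < v (x i - x j).

Definition converges_to x (l : K) : Prop :=
  forall g, value_group v g -> exists i0, forall i,
    (i0 <= i)%O -> Fin g < v (l - x i).

End Completion.

Definition is_complete (K : fieldType) (G : orderedAbelianGroup)
    (v : krull_valuation K G) : Prop :=
  forall d (I : orderType d), is_cofinality I (value_group v) ->
  forall x : I -> K, is_cauchy v x -> exists l, converges_to v x l.

Record is_completion (K Kc : fieldType) (G : orderedAbelianGroup)
    (v : krull_valuation K G) (vc : krull_valuation Kc G)
    (iota : {rmorphism K -> Kc}) : Prop := {
  completion_ext : forall x, vc (iota x) = v x;
  completion_complete : is_complete vc;
  completion_dense : forall (y : Kc) g, value_group vc g ->
    exists x : K, Fin g < vc (y - iota x)
}.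

(* Main.v *)
(* An element y of Kc is sent to the class modulo U_v^γ of any x in K with
   x in y U_vc^γ; such x exist by density, as v(x - y) > γ + v(y) is enough.
   A compatible family of nonzero classes [x_γ] has a common value h, and
   v(x_δ - x_γ) > γ + h for δ >= γ, so it is Cauchy along a sequence indexed by
   the cofinality of vK; its limit is the unique element of Kc with these
   classes. If t lies in y ⊞ z modulo every U^γ, then
   v(t - y - z) > γ + min(v(y), v(z)) for every γ, that is t = y + z; hence the
   map into Kc induced by a cone is a homomorphism.

   Completeness only speaks about sequences indexed by the cofinality of vK, so
   that ordinal has to be produced: inside a well-ordering of Γ, it is the least
   initial segment that has a cofinal map into vK. *)

From HB Require Import structures.
From mathcomp Require Import all_boot all_order all_algebra.
From mathcomp Require Import boolp classical_sets wochoice.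
Require Import Defs.

Set Implicit Arguments.
Unset Strict Implicit.
Unset Printing Implicit Defensive.

Import Order.TTheory GRing.Theory Num.Theory.
Local Open Scope classical_set_scope.
Local Open Scope ring_scope.

(** * Existence of well-orderings *)

Section OrderOfRelation.
Variables (T : choiceType) (R : rel T).
Hypotheses (Rxx : reflexive R) (Ranti : antisymmetric R).
Hypotheses (Rtrans : transitive R) (Rtot : total R).

Let ordered : Type := T.

HB.instance Definition _ := Choice.on ordered.
HB.instance Definition _ :=
  Order.Le_isPOrder.Build (Order.Disp tt tt) ordered Rxx Ranti Rtrans.
HB.instance Definition _ :=
  Order.POrder_isTotal.Build (Order.Disp tt tt) ordered Rtot.

Lemma order_of_relation :
  exists (I : orderType (Order.Disp tt tt)) (e : I -> T),
    range e = setT /\ forall i j, (i <= j)%O = R (e i) (e j).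
Proof.
exists ordered, id; split=> //; by apply/seteqP; split=> // x _; exists x.
Qed.

End OrderOfRelation.

Lemma well_orderable (T : choiceType) :
  exists (I : orderType (Order.Disp tt tt)) (e : I -> T),
    is_well_order I /\ range e = setT.
Proof.
have [R Rwo] := well_ordering_principle T.
have RwoT : wo_chain R predT by apply: withinW.
have Rxx : reflexive R by move=> x; exact: (wo_chain_reflexive RwoT).
have Ranti : antisymmetric R.
  by move=> x y; exact: (wo_chain_antisymmetric RwoT).
have Rtot : total R by move=> x y; exact: (wo_chainW RwoT).
(* The least element [m] of [x, y, z] decides: [m = x] gives [R x z] directly, while [m = y] or
   [m = z] forces [x = y] or [y = z] by antisymmetry. *)
have Rtrans : transitive R.
  move=> y x z Rxy Ryz.
  have [|m [[mA mlb] _]] := Rwo [pred w | w \in [:: x; y; z]].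
    by exists x; rewrite !inE eqxx.
  have Rmx : R m x by apply: mlb; rewrite !inE eqxx.
  have Rmy : R m y by apply: mlb; rewrite !inE eqxx !orbT.
  have Rmz : R m z by apply: mlb; rewrite !inE eqxx !orbT.
  move: mA; rewrite !inE => /or3P[] /eqP em; subst m => //.
    by have /Ranti-> : R x y && R y x by rewrite Rxy.
  by have /Ranti<- : R y z && R z y by rewrite Ryz.
have [I [e [eT leE]]] := order_of_relation Rxx Ranti Rtrans Rtot.
exists I, e; split=> // A [a Aa].
have [|m [[/set_mem[i Ai <-] mlb] _]] := Rwo (mem (e @` A)).
  by exists (e a); apply/mem_set; exists a.
by exists i => // j Aj; rewrite leE; apply: mlb; apply/mem_set; exists j.
Qed.

(** * Initial segments and cofinality *)

Definition initial_segment d (I : orderType d) (i : I) : Type :=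
  {j : I | (j < i)%O}.

HB.instance Definition _ d (I : orderType d) (i : I) :=
  SubType.on (initial_segment i).
HB.instance Definition _ d (I : orderType d) (i : I) :=
  [Choice of initial_segment i by <:].
HB.instance Definition _ d (I : orderType d) (i : I) :=
  [SubChoice_isSubOrder of initial_segment i by <: with d].

Lemma initial_segment_wo d (I : orderType d) (i : I) :
  is_well_order I -> is_well_order (initial_segment i).
Proof.
move=> Iwo A [a Aa]; have [|_ [m Am <-] mlb] := Iwo (val @` A).
  by exists (val a), a.
by exists m => // j Aj; rewrite leEsub; apply: mlb; exists j.
Qed.

Lemma wo_wf d (I : orderType d) :
  is_well_order I -> well_founded (fun i j : I => (i < j)%O).
Proof.
move=> Iwo i; apply: contrapT => nAi.
have [|m nAm mlb] := Iwo [set i | ~ Acc (fun i j : I => (i < j)%O) i].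
  by exists i.
apply: nAm; constructor=> j jm; apply: contrapT => /mlb.
by rewrite leNgt jm.
Qed.

(** Transfinite recursion: [f i] is the least element of [J] not taken at an index below [i]. Either
    a new element is always available and [f] is strictly increasing, or the values before some [i]
    already exhaust [J]. *)
Lemma wo_embed_or_cover d (I : orderType d) d' (J : orderType d') :
  is_well_order I -> is_well_order J -> inhabited J ->
  (exists f : I -> J, {homo f : i j / (i < j)%O}) \/
  (exists (i : I) (g : initial_segment i -> J), range g = setT).
Proof.
move=> Iwo Jwo [j0].
pose fresh i (F : forall k : I, (k < i)%O -> J) : set J :=
  [set j | forall k (ki : (k < i)%O), F k ki <> j].
(* For empty [A] the default [j0] stands in, so that the recursion has a value at every stage. *)
have least (A : set J) :
    exists j, A !=set0 -> A j /\ forall k, A k -> (j <= k)%O.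
  have [/Jwo[j Aj jlb]|A0] := pselect (A !=set0); first by exists j.
  by exists j0.
pose f := Fix (wo_wf Iwo) (fun=> J) (fun i F => sval (cid (least (fresh i F)))).
have fE i : fresh i (fun k _ => f k) !=set0 ->
    fresh i (fun k _ => f k) (f i) /\
    forall j, fresh i (fun k _ => f k) j -> (f i <= j)%O.
  rewrite {3 5}/f Fix_eq; first by case: cid.
  move=> k F F' FF'; congr (sval (cid (least _))).
  by congr fresh; apply: functional_extensionality_dep => l;
    apply: functional_extensionality_dep.
have [[i nfi]|allf] :=
  pselect (exists i, ~ (fresh i (fun k _ => f k) !=set0)); [right|left].
  exists i, (f \o val); apply/seteqP; split=> // j _; apply: contrapT => nj.
  by apply: nfi; exists j => k ki fkj; apply: nj; exists (Sub k ki).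
have {fE allf} fE i := fE i (contrapT (fun h => allf (ex_intro _ i h))).
(* What is fresh at [j] is fresh at [i < j], so minimality gives [f i <= f j], and freshness
   excludes equality. *)
exists f => i j ij; have [fi _] := fE j; have [_ fl] := fE i.
rewrite lt_neqAle; apply/andP; split; first by apply/eqP; exact: fi.
by apply: fl => k ki; apply: fi; exact: lt_trans ij.
Qed.

Lemma cofinality_exists (G : porderZmodType) (S : set G) : S !=set0 ->
  exists I : orderType (Order.Disp tt tt), is_cofinality I S.
Proof.
move=> [s0 Ss0]; have [I [e [Iwo eI]]] := well_orderable G.
have cofI : has_cofinal_map I S.
  (* The well-ordering runs through all of [G]; its points outside [S] are sent to [s0]. *)
  exists (fun i => if `[< S (e i) >] then e i else s0).
    by move=> _ [i _ <-]; case: asboolP.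
  move=> s Ss; have [i _ eis] : range e s by rewrite eI.
  by exists i; rewrite eis; case: asboolP.
(* If [L] did not embed in [J], a proper initial segment of [L] would cover [J], and composing with
   a cofinal map of [J] would make that segment cofinal. *)
have minimal d (L : orderType d) : is_well_order L -> has_cofinal_map L S ->
    (forall i : L, ~ has_cofinal_map (initial_segment i) S) ->
    is_cofinality L S.
  move=> Lwo cofL nL; split=> // d' J Jwo [f fS fcof].
  have J0 : inhabited J by have [j _] := fcof _ Ss0.
  have [//|[i [g gJ]]] := wo_embed_or_cover Lwo Jwo J0.
  case: (nL i); exists (f \o g) => [_ [k _ <-]|s /fcof[j sj]].
    by apply: fS; exists (g k).
  by have [k _ gk] : range g j by [rewrite gJ]; exists k; rewrite /= gk.
pose A := [set i : I | has_cofinal_map (initial_segment i) S].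
have [/Iwo[i Ai ilb]|A0] := pselect (A !=set0); last first.
  by exists I; apply: minimal => // i Ai; apply: A0; exists i.
exists (initial_segment i); apply: minimal => //.
  exact: initial_segment_wo.
(* A segment of the segment below [i] is a segment of [I] itself, so a cofinal map on it contradicts
   the leastness of [i]. *)
move=> k [f fS fcof]; have /ilb : A (val k).
  have ki (l : initial_segment (val k)) : (val l < i)%O.
    by apply: lt_trans (valP l) (valP k).
  have lk (l : initial_segment k) : (val (val l) < val k)%O.
    exact: (valP l).
  exists (fun l => f (Sub (Sub (val l) (ki l)) (valP l))).
    by move=> _ [l _ <-]; apply: fS; exists (Sub (Sub (val l) (ki l)) (valP l)).
  move=> s /fcof[l sl]; exists (Sub (val (val l)) (lk l)); congr (_ <= f _): sl.
  by do 2 apply: val_inj.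
by rewrite leNgt (valP k).
Qed.

(** At the least [m] with [h m < m], monotonicity would give [h (h m) < h m], a smaller such
    point. *)
Lemma wo_homo_ge d (I : orderType d) (h : I -> I) :
  is_well_order I -> {homo h : i j / (i < j)%O} -> forall i, (i <= h i)%O.
Proof.
move=> Iwo hlt i; rewrite leNgt; apply/negP => hi.
have [|m /= hm mlb] := Iwo [set i | (h i < i)%O]; first by exists i.
by have := mlb _ (hlt _ _ hm); rewrite leNgt hm.
Qed.

(* A cofinal map [f] need not be monotone, but by minimality of [I] each [f j],
   [j < i], lies below some element of [S] that depends only on [i]. *)
Lemma cofinality_net (G : orderedAbelianGroup) d (I : orderType d) (S : set G) :
  is_cofinality I S -> exists F : I -> G,
    (forall i, S (F i)) /\
    forall s, S s -> exists i0, forall i, (i0 <= i)%O -> s <= F i.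
Proof.
move=> [Iwo [f fS fcof] Imin].
have le_tot := @le_total_oag G.
suff /choice[F FP] : forall i,
    exists t, S t /\ forall j, (j <= i)%O -> f j <= t.
  exists F; split=> [i|s /fcof[i0 si0]]; first by have [] := FP i.
  exists i0 => i i0i; have [_ /(_ _ i0i)] := FP i; exact: le_trans.
move=> i; have [s [Ss sub]] : exists s, S s /\ forall j, (j < i)%O -> f j <= s.
  (* Otherwise [f] would be cofinal already on the segment below [i], and minimality would embed [I]
     in it, sending [i] strictly below itself. *)
  apply: contrapT => unb; have [||h hlt] := Imin _ (initial_segment i).
  - exact: initial_segment_wo.
  - exists (f \o val) => [_ [j _ <-]|s Ss]; first by apply: fS; exists (val j).
    apply: contrapT => ns; apply: unb; exists s; split=> // j ji.
    case/orP: (le_tot (f j) s) => // sj; case: ns.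
    by exists (Sub j ji).
  have := @wo_homo_ge _ _ (val \o h) Iwo hlt i.
  by rewrite leNgt (valP (h i)).
have Sfi : S (f i) by apply: fS; exists i.
case/orP: (le_tot s (f i)) => sf.
- exists (f i); split=> // j; rewrite le_eqVlt => /predU1P[->//|/sub js].
  exact: le_trans sf.
- exists s; split=> // j; rewrite le_eqVlt => /predU1P[->//|]; exact: sub.
Qed.

(** * Value groups and ultrametric estimates *)

Section ValueGroup.
Variables (K : fieldType) (G : orderedAbelianGroup) (v : krull_valuation K G).

Lemma leD2r (x y z : G) : (x + z <= y + z) = (x <= y).
Proof. by rewrite ![_ + z]addrC leD2l. Qed.

Lemma ext_ltD2l (x : G) b c :
  (ext_add (Fin x) b < ext_add (Fin x) c) = (b < c).
Proof. by rewrite !ltNge ext_leD2l. Qed.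

Lemma value_group0 : value_group v 0.
Proof. by exists (1 : K); [exact/eqP/oner_neq0 | exact: kval1]. Qed.

Definition value_group_ge0_zero : value_group_ge0 v :=
  exist _ 0 (mem_set (conj value_group0 (lexx 0))).

Lemma value_groupI (x : K) g : v x = Fin g -> value_group v g.
Proof. by move=> vx; exists x => //; move/(val_Infty v); rewrite vx. Qed.

Lemma value_groupD g h :
  value_group v g -> value_group v h -> value_group v (g + h).
Proof.
move=> [x _ vx] [y _ vy]; apply: (@value_groupI (x * y)).
by rewrite kvalM vx vy.
Qed.

Lemma kvalV (x : K) g : v x = Fin g -> v x^-1 = Fin (- g).
Proof.
move=> vx; have x0 : x != 0.
  by apply/eqP => /(kval_Infty v); rewrite vx.
have := kvalM v x x^-1; rewrite mulfV// kval1 vx.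
by case: (v x^-1) => //= h [] /esym/eqP; rewrite addrC addr_eq0 => /eqP ->.
Qed.

Lemma value_groupN g : value_group v g -> value_group v (- g).
Proof. by move=> [x _ vx]; apply: (@value_groupI x^-1); exact: kvalV. Qed.

Lemma value_groupB g h :
  value_group v g -> value_group v h -> value_group v (g - h).
Proof. by move=> vg /value_groupN; exact: value_groupD. Qed.

Lemma kval_fin (x : K) : x <> 0 -> exists g, v x = Fin g.
Proof. exact: (@val_fin _ _ v x). Qed.

(** Since [0] has value [Infty], the minimum of two values need not be finite; [h] replaces it in
    estimates. *)
Lemma kval_lbound (x y : K) :
  exists h, [/\ value_group v h, Fin h <= v x & Fin h <= v y].
Proof.
have lb z : exists2 h, value_group v h & Fin h <= v z.
  have [->|/eqP/kval_fin[g vz]] := eqVneq z 0.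
    by exists 0; [exact: value_group0 | rewrite kval0 le_Infty].
  by exists g; [exact: value_groupI vz | rewrite vz].
have [g vg gx] := lb x; have [h vh hy] := lb y.
case/orP: (le_total_oag g h) => gh.
  by exists g; split=> //; apply: le_trans hy.
by exists h; split=> //; apply: le_trans gx.
Qed.

Lemma kvalB_lt (x y z : K) g :
  Fin g < v (x - z) -> Fin g < v (z - y) -> Fin g < v (x - y).
Proof.
move=> gxz gzy; have -> : x - y = (x - z) + (z - y) by rewrite addrA subrK.
by apply: lt_le_trans (kvalD _ _ _); rewrite lt_min gxz.
Qed.

Lemma kval_eq_of_near (x y : K) g :
  v y = Fin g -> Fin g < v (x - y) -> v x = Fin g.
Proof.
move=> vy gxy; apply/le_anti/andP; split.
  have := kvalD v x (- (x - y)); rewrite kvalN opprB addrCA subrr addr0 vy.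
  by rewrite ge_min => /orP[//|]; rewrite leNgt gxy.
have := kvalD v (x - y) y; rewrite subrK vy; apply: le_trans.
by rewrite le_min lexx ltW.
Qed.

(** If [v x = Fin k] with [k - h >= 0], then [g = k - h] would give [k < k]; otherwise [g = 0] gives
    [h < k], again impossible. *)
Lemma kval_eq0 (x : K) h : value_group v h ->
  (forall g, value_group_ge0 v g -> Fin (g + h) < v x) -> x = 0.
Proof.
move=> vh big; apply: contrapT => /kval_fin[k vx].
have vkh : value_group v (k - h) by apply: value_groupB (value_groupI vx) vh.
case/orP: (le_total_oag 0 (k - h)) => kh.
  by have := big (k - h) (conj vkh kh); rewrite vx subrK ltxx.
have := big 0 (conj value_group0 (lexx 0)).
rewrite vx add0r lt_Fin => hk.
have kh' : k <= h by rewrite -(leD2r _ _ (- h)) subrr.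
by have := lt_le_trans hk kh'; rewrite ltxx.
Qed.

(** Multiplicative closeness becomes additive closeness. A lower bound [h] on [v y] suffices, so
    [y = 0] is covered. *)
Lemma one_units_mulB (g h : G) (y u : K) :
  Fin h <= v y -> one_units v g u -> Fin (g + h) < v (y * u - y).
Proof.
move=> hy gu; have -> : y * u - y = y * (u - 1) by rewrite mulrBr mulr1.
rewrite kvalM; case: (v y) hy => // k hk.
apply: (@le_lt_trans _ _ (ext_add (Fin k) (Fin g))); last by rewrite ext_ltD2l.
by rewrite /= le_Fin addrC leD2r.
Qed.

(** The passage back: dividing by [y] lowers values by exactly [h]. *)
Lemma one_units_div (g h : G) (x y : K) :
  v y = Fin h -> Fin (g + h) < v (x - y) -> one_units v g (x / y).
Proof.
move=> vy xy; have y0 : y != 0.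
  by apply/eqP => /(kval_Infty v); rewrite vy.
rewrite /one_units /=; have -> : x / y - 1 = y^-1 * (x - y).
  by rewrite mulrBr mulVf// mulrC.
rewrite kvalM (kvalV vy) -(ext_ltD2l h) ext_addA.
have -> : ext_add (Fin h) (Fin (- h)) = Fin 0 by rewrite /= subrr.
by rewrite ext_add0 /= addrC.
Qed.

End ValueGroup.

(** * Classes in the γ-hyperfields *)

Section GammaClasses.
Variables (K : fieldType) (G : orderedAbelianGroup) (v : krull_valuation K G).

Lemma gcls_eq_near (g : value_group_ge0 v) (x y : K) h :
  v y = Fin h -> gcls g x = gcls g y -> Fin (val g + h) < v (x - y).
Proof.
move=> vy /(clsP (gamma_subgroup g))[u Uu ->].
by apply: one_units_mulB => //; rewrite vy.
Qed.

Lemma gclsM (g : value_group_ge0 v) (x y : K) :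
  hmul (gcls g x) (gcls g y) = gcls g (x * y).
Proof. exact: (clsM (gamma_subgroup g)). Qed.

Lemma gclsD (g : value_group_ge0 v) (x y : K) :
  (gcls g x ⊞ gcls g y) (gcls g (x + y)).
Proof.
rewrite /= (clsD (gamma_subgroup g)); exists 1; last by rewrite mulr1.
exact: (unit_subgroup1 (gamma_subgroup g)).
Qed.

Lemma gcls_add (g : value_group_ge0 v) (x y z : K) :
  (gcls g x ⊞ gcls g y) (gcls g z) -> exists2 u, one_units v (val g) u &
    gcls g (x + y * u) = gcls g z.
Proof. by rewrite /= (clsD (gamma_subgroup g)). Qed.

Lemma gcls_eq0 (g : value_group_ge0 v) (x : K) : gcls g x = hzero <-> x = 0.
Proof. exact: (cls_eq0 (gamma_subgroup g)). Qed.

End GammaClasses.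

(** * Equality of arrows in the slice category *)

Section SliceArrows.
Variables (G : orderedAbelianGroup) (a b : slice (vtropical G)).

Lemma slice_hom_ext (f g : hom a b) :
  (forall t, slice_map f t = slice_map g t) -> f = g.
Proof. by move=> fg; apply: slice_hom_eq; exact: vhyp_hom_eq. Qed.

Lemma slice_hom_congr (f g : hom a b) t :
  f = g -> slice_map f t = slice_map g t.
Proof. by move=> ->. Qed.

End SliceArrows.

(** * Value group of the completion and limits of compatible families *)

Section Completion.
Variables (G : orderedAbelianGroup) (K : fieldType) (v : krull_valuation K G).
Variables (Kc : fieldType) (vc : krull_valuation Kc G).
Variables (iota : {rmorphism K -> Kc}) (hKc : is_completion v vc iota).

Let vciota x : vc (iota x) = v x. Proof. exact: completion_ext hKc x. Qed.

(** By density a nonzero [y] has an approximation from [K] that is closer than [vc y], hence of the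
    same value. *)
Lemma value_group_completion : value_group vc = value_group v.
Proof.
apply/seteqP; split=> g [y y0 vy]; last first.
  by apply: (@value_groupI _ _ vc (iota y)); rewrite vciota.
have [x gyx] := completion_dense hKc y (value_groupI vy).
apply: (@value_groupI _ _ v x); rewrite -vciota.
by apply: (kval_eq_of_near vy); rewrite -kvalN opprB.
Qed.

(** The family is indexed by values, while completeness concerns sequences along the cofinality; the
    family is pulled back along a map [D] that eventually exceeds every value. *)
Lemma complete_net (x : value_group_ge0 v -> K) (h : G) : value_group v h ->
  (forall d g, val g <= val d -> Fin (val g + h) < v (x d - x g)) ->
  exists l, forall g, Fin (val g + h) < vc (l - iota (x g)).
Proof.
move=> vh xcauchy.
have [I Icof] := cofinality_exists (ex_intro _ _ (value_group0 vc)).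
have [F [VF Fcof]] := cofinality_net Icof.
(* The values [F i] may be negative; indices of the diagram are not, so [0] takes their place. *)
have ge0 g : value_group vc g -> exists d : value_group_ge0 v, g <= val d.
  rewrite value_group_completion => vg; case/orP: (le_total_oag 0 g) => g0.
    by exists (exist _ g (mem_set (conj vg g0))).
  by exists (value_group_ge0_zero v).
have /choice[D FD] i := ge0 _ (VF i).
have far g : value_group vc g ->
    exists i0, forall i, (i0 <= i)%O -> g <= val (D i).
  move=> /Fcof[i0 gF]; exists i0 => i /gF gi; exact: le_trans (FD i).
have vhc : value_group vc h by rewrite value_group_completion.
have [g vg|l xl] := completion_complete hKc Icof (x := fun i => iota (x (D i))).
  have [i0 i0P] := far _ (value_groupB vg vhc).
  suff xlt i j : (i0 <= i)%O -> val (D i) <= val (D j) ->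
      Fin g < vc (iota (x (D j)) - iota (x (D i))).
    exists i0 => i j ii0 ji0.
    case/orP: (le_total_oag (val (D i)) (val (D j))) => ij; last exact: xlt.
    by rewrite -kvalN opprB; exact: xlt.
  move=> /i0P gi ij; rewrite -rmorphB vciota.
  apply: le_lt_trans (xcauchy _ _ ij).
  by rewrite le_Fin -(leD2r _ _ (- h)) addrK.
exists l => g; have [vg _] := set_valP g.
rewrite -value_group_completion in vg.
have [i0 i0P] := far _ vg; have [i1 i1P] := xl _ (value_groupD vg vhc).
(* Past [i0] the index [D i] lies above [g]; past [i1] the sequence is closer to [l] than
   [g + h]. *)
set i := Order.max i0 i1.
apply: (@kvalB_lt _ _ _ _ _ (iota (x (D i)))).
  by apply: i1P; rewrite le_max lexx orbT.
by rewrite -rmorphB vciota; apply: xcauchy; apply: i0P; rewrite le_max lexx.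
Qed.

(** * The maps from the completion to the γ-hyperfields *)

Lemma approx_cls (g : value_group_ge0 v) (y : Kc) :
  exists x, exists2 u, one_units vc (val g) u & iota x = y * u.
Proof.
have [vg g0] := set_valP g.
have [->|/eqP/(kval_fin vc)[h vy]] := eqVneq y 0.
  exists 0; exists 1; rewrite ?rmorph0 ?mul0r//.
  exact: (unit_subgroup1 (one_units_subgroup vc g0)).
have vgh : value_group vc (val g + h).
  by apply: value_groupD (value_groupI vy); rewrite value_group_completion.
have [x xy] := completion_dense hKc y vgh.
exists x; exists (iota x / y).
  by apply: (one_units_div vy); rewrite -kvalN opprB.
rewrite mulrCA mulfV ?mulr1//.
by apply/eqP => /(kval_Infty vc); rewrite vy.
Qed.

Definition completion_leg (g : value_group_ge0 v) (y : Kc) :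
    gamma_hyperfield g :=
  gcls g (sval (cid (approx_cls g y))).

(** Makes the leg independent of the chosen approximation: two approximations of [y] differ by a
    factor in [K] which is a 1-unit for [vc], hence for [v]. *)
Lemma completion_legP g y x :
  completion_leg g y = gcls g x <->
  exists2 u, one_units vc (val g) u & iota x = y * u.
Proof.
have [_ g0] := set_valP g.
have Usub := one_units_subgroup vc g0.
have iotaU u : one_units v (val g) u <-> one_units vc (val g) (iota u).
  by rewrite /one_units /= -(rmorph1 iota) -rmorphB vciota.
rewrite /completion_leg; case: cid => z /= [u Uu zu].
have u0 := unit_subgroup_neq0 Usub Uu.
split=> [/esym/(clsP (gamma_subgroup g))[w Uw ->]|[w Uw xw]].
  exists (u * iota w); first by apply: (unit_subgroupM Usub) => //; apply/iotaU.
  by rewrite rmorphM zu mulrA.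
have w0 := unit_subgroup_neq0 Usub Uw.
have [y0|y0] := eqVneq y 0.
  move: zu xw; rewrite y0 !mul0r => /eqP; rewrite fmorph_eq0 => /eqP ->.
  by move=> /eqP; rewrite fmorph_eq0 => /eqP ->.
have x0 : x != 0 by rewrite -(fmorph_eq0 iota) xw mulf_neq0.
(* The image of [z / x] under [iota] is [u / w]. *)
apply/(clsP (gamma_subgroup g)); exists (z / x).
  apply/iotaU; rewrite fmorph_div zu xw -mulf_div mulfV// mul1r.
  by apply: (unit_subgroupM Usub) => //; exact: (unit_subgroupV Usub).
by rewrite mulrCA mulfV// mulr1.
Qed.

Lemma completion_legE g y : exists2 x, completion_leg g y = gcls g x &
  exists2 u, one_units vc (val g) u & iota x = y * u.
Proof.
have [x xP] := approx_cls g y; exists x => //; exact/completion_legP.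
Qed.

Lemma completion_leg_near g y x h : vc y = Fin h ->
  Fin (val g + h) < vc (iota x - y) -> completion_leg g y = gcls g x.
Proof.
move=> vy xy; apply/completion_legP; exists (iota x / y).
  exact: one_units_div vy xy.
rewrite mulrCA mulfV ?mulr1//.
by apply/eqP => /(kval_Infty vc); rewrite vy.
Qed.

Lemma completion_leg0 g : completion_leg g 0 = hzero.
Proof.
have [x -> [u _]] := completion_legE g 0; rewrite mul0r => /eqP.
by rewrite fmorph_eq0 => /eqP ->.
Qed.

Lemma gamma_val_completion_leg g y : gamma_val (completion_leg g y) = vc y.
Proof.
have [x -> [u Uu xu]] := completion_legE g y.
have vu : vc u = Fin 0 := val_one_unit (proj2 (set_valP g)) Uu.
by rewrite gamma_val_cls -[v x]vciota xu kvalM vu ext_addC ext_add0.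
Qed.

Lemma completion_leg_eq0 g y : completion_leg g y = hzero -> y = 0.
Proof.
by move=> /gamma_val_Infty; rewrite gamma_val_completion_leg => /kval_Infty.
Qed.

Lemma completion_legM g y z :
  completion_leg g (y * z) = hmul (completion_leg g y) (completion_leg g z).
Proof.
have [_ g0] := set_valP g.
have [x1 -> [u1 U1 x1u]] := completion_legE g y.
have [x2 -> [u2 U2 x2u]] := completion_legE g z.
rewrite gclsM; apply/completion_legP; exists (u1 * u2).
  exact: (unit_subgroupM (one_units_subgroup vc g0)).
by rewrite rmorphM x1u x2u mulrACA.
Qed.

(** Approximating [y] beyond both [h] and [val g + vc y] fixes the class and gives the extra
    precision that sums with cancellation require. *)
Lemma completion_leg_approx g y h : value_group v h ->
  exists2 x, completion_leg g y = gcls g x & Fin h < vc (iota x - y).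
Proof.
move=> vh; have [->|/eqP/(kval_fin vc)[k vy]] := eqVneq y 0.
  exists 0; first exact: completion_leg0.
  by rewrite rmorph0 subrr kval0.
have [vg _] := set_valP g.
have vgk : value_group vc (val g + k).
  by apply: value_groupD (value_groupI vy); rewrite value_group_completion.
rewrite -value_group_completion in vh.
have [m vm [hm km]] : exists2 m, value_group vc m & h <= m /\ val g + k <= m.
  case/orP: (le_total_oag h (val g + k)) => hk; last by exists h.
  by exists (val g + k).
have [x xy] := completion_dense hKc y vm; exists x.
  apply: (completion_leg_near vy); rewrite -kvalN opprB.
  by apply: le_lt_trans xy; rewrite le_Fin.
by rewrite -kvalN opprB; apply: le_lt_trans xy; rewrite le_Fin.
Qed.

Lemma completion_legD g y z :
  (completion_leg g y ⊞ completion_leg g z) (completion_leg g (y + z)).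
Proof.
have [vg g0] := set_valP g.
(* The precision must be measured against the value of [y + z], which may exceed those of [y] and
   [z]. If [y + z = 0] there is no finite target, and the representatives [x] and [- x] are used. *)
have [yz0|/eqP/(kval_fin vc)[h vyz]] := eqVneq (y + z) 0.
  have [x -> [u Uu xu]] := completion_legE g y.
  have -> : completion_leg g z = gcls g (- x).
    apply/completion_legP; exists u => //.
    move/eqP: yz0; rewrite addr_eq0 => /eqP yz.
    by rewrite rmorphN xu yz mulNr opprK.
  rewrite yz0 completion_leg0; have := gclsD g x (- x); by rewrite subrr.
have vgh : value_group v (val g + h).
  apply: value_groupD vg _; rewrite -value_group_completion.
  exact: value_groupI vyz.
have [x1 -> x1y] := completion_leg_approx g y vgh.
have [x2 -> x2z] := completion_leg_approx g z vgh.
rewrite (completion_leg_near (x := x1 + x2) vyz); first exact: gclsD.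
rewrite rmorphD opprD addrACA; apply: lt_le_trans (kvalD _ _ _).
by rewrite lt_min x1y.
Qed.

Lemma completion_leg_hom g :
  @is_hyperfield_hom (field_hyperfield Kc) _ (completion_leg g).
Proof.
split.
- exact: completion_leg0.
- by move=> y y0 /completion_leg_eq0.
- by move=> y z _ _; exact: completion_legM.
- by move=> y z _ [_ -> <-]; exact: completion_legD.
Qed.

Lemma rho_completion_leg (d g : value_group_ge0 v) y : val g <= val d ->
  rho g (completion_leg d y) = completion_leg g y.
Proof.
move=> gd; have [x -> [u Uu xu]] := completion_legE d y.
rewrite (rho_cls gd); apply/esym/completion_legP; exists u => //.
by apply: le_lt_trans Uu; rewrite le_Fin.
Qed.

(** The legs jointly detect sums: at each level [k], [t] is [y] times a 1-unit plus [z] times a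
    1-unit. *)
Lemma completion_leg_add y z t :
  (forall g,
    (completion_leg g y ⊞ completion_leg g z) (completion_leg g t)) ->
  t = y + z.
Proof.
move=> yzt; have [h [vh hy hz]] := kval_lbound vc y z.
apply/eqP; rewrite -subr_eq0; apply/eqP.
apply: (kval_eq0 vh) => k [vk k0]; rewrite value_group_completion in vk.
pose g : value_group_ge0 v := exist _ k (mem_set (conj vk k0)).
have Usub := one_units_subgroup vc k0.
have := yzt g.
have [x1 -> [u1 U1 x1u]] := completion_legE g y.
have [x2 -> [u2 U2 x2u]] := completion_legE g z.
have [x3 -> [u3 U3 x3u]] := completion_legE g t.
move=> /gcls_add[u Uu /(clsP (gamma_subgroup g))[w Uw]] /(congr1 iota).
have iotaU a : one_units v k a -> one_units vc k (iota a).
  by rewrite /one_units /= -(rmorph1 iota) -rmorphB vciota.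
have w0 := unit_subgroup_neq0 Usub (iotaU _ Uw).
have u30 := unit_subgroup_neq0 Usub U3.
rewrite rmorphD !rmorphM x1u x2u x3u => tE.
(* The relation [tE] is divided by [u3 * iota w]. *)
have -> : t - (y + z) = (y * (u1 / (u3 * iota w)) - y) +
    (z * (u2 * iota u / (u3 * iota w)) - z).
  rewrite addrACA -opprD; congr (_ - _).
  by rewrite !mulrA -mulrDl tE -(mulrA t) mulfK// mulf_neq0.
have U3w : one_units vc k (u3 * iota w)^-1.
  apply: (unit_subgroupV Usub); apply: (unit_subgroupM Usub) => //.
  exact: iotaU.
apply: lt_le_trans (kvalD _ _ _); rewrite lt_min.
apply/andP; split; apply: one_units_mulB => //.
  exact: (unit_subgroupM Usub).
apply: (unit_subgroupM Usub) => //.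
by apply: (unit_subgroupM Usub) => //; exact: iotaU.
Qed.

(** The case of a zero summand, where the hypersum is a singleton. *)
Lemma completion_leg_inj y z :
  (forall g, completion_leg g y = completion_leg g z) -> y = z.
Proof.
move=> yz; rewrite -[z]addr0; apply: completion_leg_add => g.
by rewrite yz completion_leg0 hadd0.
Qed.

Lemma completion_leg_lift
    (A : forall g : value_group_ge0 v, gamma_hyperfield g) :
  (forall d g, val g <= val d -> rho g (A d) = A g) ->
  exists y, forall g, completion_leg g y = A g.
Proof.
move=> rhoA; pose x g := rep (A g).
have xA g : gcls g (x g) = A g by exact: repK.
pose z := value_group_ge0_zero v.
have zmin (g : value_group_ge0 v) : val z <= val g by have [] := set_valP g.
(* Every class maps to the one at index [0], and [rho] preserves values. *)
have vx g : v (x g) = v (x z).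
  rewrite -(gamma_val_cls g) -(gamma_val_cls z) !xA -(rhoA g z) //.
  by apply/esym; exact: rho_val (zmin g) (A g).
have [xz0|/eqP/(kval_fin v)[h vxz]] := eqVneq (x z) 0.
  exists 0 => g; rewrite completion_leg0 -xA; apply/esym/gcls_eq0.
  by apply/(kval_Infty v); rewrite vx xz0 kval0.
have [l xl] : exists l, forall g, Fin (val g + h) < vc (l - iota (x g)).
  apply: complete_net (value_groupI vxz) _ => d g gd.
  by apply: gcls_eq_near; rewrite ?vx// xA -(rhoA d g)// -xA (rho_cls gd).
exists l => g; rewrite -xA; apply: (completion_leg_near (h := h)).
  (* Index [0] shows that [l] is closer to [x z] than [h], so [l] has value [h] too. *)
  apply: (@kval_eq_of_near _ _ _ _ (iota (x z))); first by rewrite vciota.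
  by have := xl z; rewrite /= add0r.
by rewrite -kvalN opprB.
Qed.

(** * The limit cone *)

Lemma completion_leg_ring (g : value_group_ge0 v) :
  completion_leg g @` valuation_ring vc `<=` valuation_ring (gamma_valuation g).
Proof.
by move=> _ [y y0 <-]; rewrite /valuation_ring /= gamma_val_completion_leg.
Qed.

Definition completion_leg_vhyp (g : value_group_ge0 v) :
    @hom vHyp (ValuedHyperfield vc) (ValuedHyperfield (gamma_valuation g)) :=
  @VHypHom (ValuedHyperfield vc) (ValuedHyperfield (gamma_valuation g))
    (completion_leg g) (completion_leg_hom g) (@completion_leg_ring g).

Lemma completion_leg_slice (g : value_group_ge0 v) :
  comp (slice_arr (gamma_obj g)) (completion_leg_vhyp g) =
  slice_arr (val_slice vc).
Proof. by apply: vhyp_hom_eq => y; exact: gamma_val_completion_leg. Qed.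

Definition completion_leg_arrow (g : value_group_ge0 v) :
    hom (val_slice vc) (gamma_obj g) :=
  @SliceHom vHyp (vtropical G) (val_slice vc) (gamma_obj g)
    (completion_leg_vhyp g) (completion_leg_slice g).

Lemma completion_leg_comm
    (d g : ge_category (value_group_ge0 v)) (gd : hom d g) :
  comp (fmap (gamma_diagram v) gd) (completion_leg_arrow d) =
  completion_leg_arrow g.
Proof.
by apply: slice_hom_eq; apply: vhyp_hom_eq => y; exact: rho_completion_leg.
Qed.

Definition completion_cone : cone (gamma_diagram v) (val_slice vc) :=
  @Cone _ _ (gamma_diagram v) (val_slice vc) completion_leg_arrow
    completion_leg_comm.

(** The legs lift compatible families, are jointly injective and jointly detect sums, so the induced
    map is built pointwise and its properties are checked on the legs. *)
Lemma completion_cone_limit : is_limit_cone completion_cone.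
Proof.
move=> Y d; pose H : valued_hyperfield := slice_dom Y.
pose D (g : value_group_ge0 v) (t : H) : gamma_hyperfield g :=
  slice_map (d g) t.
have Dhom g : is_hyperfield_hom (D g) := vhyp_map_hom (slice_map (d g)).
pose a (t : H) : ext G := slice_arr Y t.
have Dval g t : gamma_val (D g t) = a t.
  by have := slice_comm (d g) => /(congr1 (fun f : vhyp_hom _ _ => f t)).
have Drho e g t : val g <= val e -> rho g (D e t) = D g t.
  move=> ge; exact: slice_hom_congr t (@leg_comm _ _ _ _ d e g ge).
have /choice[f fD] t : exists y, forall g, completion_leg g y = D g t.
  by apply: completion_leg_lift => e g; exact: Drho.
(* One leg, at index [0], already decides the value and the vanishing of [f t]. *)
pose z := value_group_ge0_zero v.
have fval t : vc (f t) = a t by rewrite -(gamma_val_completion_leg z) fD Dval.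
have fhom : @is_hyperfield_hom H (field_hyperfield Kc) f.
  split.
  - by apply: (@completion_leg_eq0 z); rewrite fD (hhom0 (Dhom z)).
  - move=> t t0 ft0; have := hhom_neq0 (Dhom z) t0; apply.
    by rewrite -fD ft0; exact: completion_leg0.
  - move=> s t s0 t0; apply: completion_leg_inj => g.
    by rewrite completion_legM !fD (hhomM (Dhom g)).
  - move=> s t _ [r rst <-]; apply: completion_leg_add => g.
    by rewrite !fD; apply: (hhomD (Dhom g)); exists r.
have fring : f @` valuation_ring (vh_val H) `<=` valuation_ring vc.
  move=> _ [t t0 <-]; rewrite /valuation_ring /= fval.
  by apply: (@vhyp_map_ring _ _ (slice_arr Y)); exists t.
pose fv : @hom vHyp H (ValuedHyperfield vc) :=
  @VHypHom H (ValuedHyperfield vc) f fhom fring.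
have fcomm : comp (slice_arr (val_slice vc)) fv = slice_arr Y.
  by apply: vhyp_hom_eq => t; exact: fval.
exists (@SliceHom vHyp (vtropical G) Y (val_slice vc) fv fcomm); split.
  by move=> g; apply: slice_hom_ext => t; exact: fD.
move=> f' f'D; apply: slice_hom_ext => t; apply: completion_leg_inj => g.
by rewrite fD; exact/esym/(slice_hom_congr t (f'D g)).
Qed.

End Completion.

Theorem theorem4p6 (G : orderedAbelianGroup)
    (K : fieldType) (v : krull_valuation K G)
    (Kc : fieldType) (vc : krull_valuation Kc G)
    (iota : {rmorphism K -> Kc}) (hKc : is_completion v vc iota) :
  exists c : cone (gamma_diagram v) (val_slice vc), is_limit_cone c.
Proof. by exists (completion_cone hKc); exact: completion_cone_limit. Qed.
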